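(* Let $q$ be a prime power and let $n,d$ be positive integers. Then $$\chi_d(n,q)\ \le\ q^{\left\lceil \log_{q}\left[2+\binom{n-1}{d-1}(q-1)^{d-1}\right]\right\rceil}.$$
   Context: Let $V_n=\mathbb{F}_q^n$ be the set of all length-$n$ vectors over the finite field $\mathbb{F}_q$. The Hamming distance $d_H(\mathbf{x},\mathbf{y})$ between $\mathbf{x},\mathbf{y}\in V_n$ is the number of coordinates in which they differ. A coloring $\Gamma:V_n\to\{1,\dots,L\}$ is called an exactly $d$-distance coloring if $\Gamma(\mathbf{x})\neq\Gamma(\mathbf{y})$ for all $\mathbf{x},\mathbf{y}\in V_n$ with $d_H(\mathbf{x},\mathbf{y})= d$. $\chi_d(n,q)$ denotes the minimum number $L$ of colors for which an exactly $d$-distance coloring of $V_n$ exists. *)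

(* Defs.v *)
From HB Require Import structures.
From mathcomp Require Import all_boot all_order all_algebra.
From mathcomp Require Import reals exp.

Set Implicit Arguments.
Unset Strict Implicit.
Unset Printing Implicit Defensive.

Import Order.TTheory GRing.Theory Num.Theory.

Local Open Scope ring_scope.

Definition hamming_dist (F : finFieldType) (n : nat) (x y : 'rV[F]_n) : nat :=
  #|[set i : 'I_n | x 0 i != y 0 i]|.

(* The L colors are the elements of 'I_L, i.e. 0, ..., L - 1. *)
Definition exact_dist_coloring (F : finFieldType) (n d L : nat)
    (G : {ffun 'rV[F]_n -> 'I_L}) : bool :=
  [forall x : 'rV[F]_n, forall y : 'rV[F]_n,
     (hamming_dist x y == d) ==> (G x != G y)].

Definition exact_dist_colorable (F : finFieldType) (n d L : nat) : bool :=
  [exists G : {ffun 'rV[F]_n -> 'I_L}, exact_dist_coloring d G].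

Lemma hamming_distxx (F : finFieldType) (n : nat) (x : 'rV[F]_n) :
  hamming_dist x x = 0%N.
Proof.
by apply/eqP; rewrite cards_eq0; apply/eqP/setP => i; rewrite !inE eqxx.
Qed.

Lemma exact_dist_colorable_ex (F : finFieldType) (n d : nat) :
  (0 < d)%N -> exists L : nat, exact_dist_colorable F n d L.
Proof.
move=> d_gt0; exists #|{: 'rV[F]_n}|.
apply/existsP; exists [ffun x => enum_rank x].
apply/forallP => x; apply/forallP => y; apply/implyP => /eqP dxy.
rewrite !ffunE; apply/eqP => /enum_rank_inj exy.
by move: d_gt0; rewrite -dxy exy hamming_distxx.
Qed.

(* The minimum exists only for d > 0: no coloring separates x from itself. *)
Definition chi (F : finFieldType) (n d : nat) (d_gt0 : (0 < d)%N) : nat :=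
  ex_minn (exact_dist_colorable_ex F n d_gt0).

Definition logb (R : realType) (b x : R) : R := ln x / ln b.

(* Main.v *)
(* Colour x by its syndrome x *m H, where H has n rows in F^r and no vector of
   weight exactly d lies in its left kernel.  As in the Gilbert-Varshamov bound,
   the rows of H are chosen greedily: a new row only has to avoid the
   combinations of the previous k < n rows with exactly d - 1 nonzero
   coefficients, and there are at most 'C(n - 1, d - 1) (q - 1)^(d - 1) < q^r
   of these. *)
Require Import Defs.
From mathcomp Require Import all_boot all_order all_algebra.
From mathcomp Require Import reals exp.

Import Order.TTheory GRing.Theory Num.Theory.

Local Open Scope ring_scope.

Lemma hamming_dist_sub {F : finFieldType} {n : nat} (x y : 'rV[F]_n) :
  hamming_dist x y = hamming_dist (x - y) 0.
Proof. by apply: eq_card => i; rewrite !inE !mxE subr_eq0. Qed.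

Lemma hamming_dist0Z {F : finFieldType} {n : nat} (a : F) (x : 'rV[F]_n) :
  a != 0 -> hamming_dist (a *: x) 0 = hamming_dist x 0.
Proof.
by move=> a0; apply: eq_card => i; rewrite !inE !mxE mulf_eq0 (negPf a0).
Qed.

Lemma hamming_dist0_row_mx {F : finFieldType} {n : nat}
    (a : 'rV[F]_1) (y : 'rV[F]_n) :
  hamming_dist (row_mx a y) 0 = ((a 0 0 != 0)%R + hamming_dist y 0%R)%N.
Proof.
rewrite /hamming_dist -!sum1_card !big_mkcond /= big_split_ord big_ord1 /=.
rewrite !inE row_mxEl mxE; congr (_ + _)%N; rewrite [RHS]big_mkcond /=.
by apply: eq_bigr => i _; rewrite !inE row_mxEr !mxE.
Qed.

(** Sort the vectors by support: there are ['C(n, w)] supports of size [w], and a vector with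
    support [A] is determined by its nonzero entries on [A]. *)
Lemma card_hamming_sphere (F : finFieldType) (n w : nat) :
  (#|[set x : 'rV[F]_n | hamming_dist x 0%R == w]| <= 'C(n, w) * (#|F| - 1) ^ w)%N.
Proof.
pose supp (x : 'rV[F]_n) := [set i | x 0 i != (0 : 'rV[F]_n) 0 i].
rewrite -sum1_card (partition_big supp (fun A : {set 'I_n} => #|A| == w)) /=; last first.
  by move=> x; rewrite inE.
apply: (@leq_trans (\sum_(A : {set 'I_n} | #|A| == w) (#|F| - 1) ^ w)); last first.
  by rewrite sum_nat_const -[in 'C(_, _)](card_ord n) -card_draws cardsE.
apply: leq_sum => A /eqP cA; rewrite sum1_card.
(* This [pffun_on] consists of the functions that vanish off [A] and are nonzero on [A]. *)
have <- : #|pffun_on (0 : F) (mem A) (predC1 (0 : F))| = ((#|F| - 1) ^ w)%N.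
  by rewrite card_pffun_on cardC1 cA subn1.
pose f (x : 'rV[F]_n) := [ffun i => x 0 i].
have f_inj : injective f.
  by move=> x y /ffunP fxy; apply/rowP => i; have := fxy i; rewrite !ffunE.
rewrite -(card_image f_inj); apply/subset_leq_card/subsetP => g /imageP[x].
rewrite unfold_in => /andP[_ /eqP xA] ->.
apply/pffun_onP; split=> [|y /imageP[i iA ->]].
  by apply/subsetP => i; rewrite -xA !inE ffunE mxE.
by move: iA; rewrite -xA !inE ffunE mxE.
Qed.

Lemma exists_parity_check (F : finFieldType) (r d n : nat) :
  (0 < d)%N -> ('C(n - 1, d - 1) * (#|F| - 1) ^ (d - 1) < #|F| ^ r)%N ->
  exists H : 'M[F]_(n, r),
    forall x : 'rV[F]_n, hamming_dist x 0 = d -> x *m H != 0.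
Proof.
(* From here [d] is the forbidden weight minus one: the number of earlier rows in a combination that
   the new row must avoid. *)
case: d => // d _; rewrite [(d.+1 - 1)%N]subn1 /=.
elim: n => [|n IHn] lt_qr.
  exists 0 => x xd; suff: (d.+1 <= 0)%N by [].
  by rewrite -xd -[leqRHS](card_ord 0) max_card.
have [|H HP] := IHn.
  (* The bound passes to fewer rows because ['C(n - 1, d) <= 'C(n, d)]. *)
  apply: leq_ltn_trans lt_qr; rewrite leq_mul2r leq_bin2l ?orbT //.
  by rewrite leq_sub2r.
pose S := [set x : 'rV[F]_n | hamming_dist x 0 == d].
(* By counting: were every vector of [F^r] such a combination, the sphere [S] would have at least
   [q^r] elements. *)
have [v vS] : exists v : 'rV[F]_r, v \notin [set x *m H | x in S].
  apply/existsP; rewrite -negb_forall; apply/negP => /forallP allS.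
  have : (#|F| ^ r <= #|[set x *m H | x in S]|)%N.
    rewrite -[X in (_ ^ X)%N]mul1n -(card_mx F 1 r); apply/subset_leq_card/subsetP => v _.
    exact: allS.
  move/leq_trans/(_ (leq_imset_card _ _)).
  move/leq_trans/(_ (card_hamming_sphere _ _ _)).
  by rewrite leqNgt; move: lt_qr; rewrite subn1 /= => ->.
exists (col_mx v H : 'M_(1 + n, r)) => x.
rewrite -[x](@hsubmxK _ 1 1 n); move: (lsubmx _) (rsubmx _) => a y.
rewrite hamming_dist0_row_mx (mul_row_col a y v H) [a]mx11_scalar mul_scalar_mx !mxE eqxx.
(* If the coefficient [a] of the new row is zero, [y] carries the whole weight. Otherwise [y] has
   weight [d], and [a v + y H = 0] would give [v = (- a^-1 y) H] with a coefficient vector still of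
   weight [d]. *)
rewrite mulr1n; have [->|a0] := eqVneq (a 0 0) 0.
  by rewrite scale0r add0r; apply: HP.
rewrite add1n => -[yd]; apply: contra vS => /eqP avyH.
apply/imsetP; exists (- (a 0 0)^-1 *: y).
  by rewrite inE hamming_dist0Z ?yd // oppr_eq0 invr_eq0.
rewrite -scalemxAl scaleNr; apply/eqP; rewrite -subr_eq0 opprK.
by rewrite -(scalerK a0 v) -scalerDr avyH scaler0.
Qed.

Lemma chi_le_expn (F : finFieldType) (n d r : nat) (d_gt0 : (0 < d)%N) :
  ('C(n - 1, d - 1) * (#|F| - 1) ^ (d - 1) < #|F| ^ r)%N ->
  (chi F n d_gt0 <= #|F| ^ r)%N.
Proof.
move=> /(exists_parity_check _ _ _ _ d_gt0)[H HP].
rewrite -[r]mul1n -(card_mx F 1 r) /chi; case: ex_minnP => m _; apply.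
apply/existsP; exists [ffun x => enum_rank (x *m H)].
apply/forallP => x; apply/forallP => y; apply/implyP => /eqP dxy.
rewrite !ffunE; apply/eqP => /enum_rank_inj exy.
(* Equal syndromes would put [x - y], of weight [d], in the left kernel of [H]. *)
have /HP : hamming_dist (x - y) 0 = d by rewrite -hamming_dist_sub.
by rewrite mulmxBl exy subrr eqxx.
Qed.

Lemma le_exp_ceil_logb (R : realType) (q m : nat) :
  (1 < q)%N -> (0 < m)%N ->
  exists2 r : nat, Num.ceil (logb (q%:R : R) m%:R) = r & (m <= q ^ r)%N.
Proof.
move=> q1 m0; have lnq : 0 < ln (q%:R : R) by rewrite ln_gt0 // ltr1n.
have l0 : 0 <= logb (q%:R : R) m%:R.
  by rewrite divr_ge0 ?(ltW lnq) // ln_ge0 // ler1n.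
(* The ceiling is an integer; its negative case contradicts [l0]. *)
case E : (Num.ceil _) => [r|r]; last first.
  by have := le_trans l0 (ceil_ge _); rewrite E ler0z.
exists r => //; have := ceil_ge (logb (q%:R : R) m%:R).
rewrite E /logb ler_pdivrMr // -pmulrn mulr_natl -lnXn ?ltr0n ?(ltnW q1) //.
by rewrite ler_ln ?posrE ?exprn_gt0 ?ltr0n ?(ltnW q1) // -natrX ler_nat.
Qed.

Theorem theorem3p4 (R : realType) (F : finFieldType) (q n d : nat)
    (card_F : #|F| = q) (n_gt0 : (0 < n)%N) (d_gt0 : (0 < d)%N) :
  (chi F n d_gt0)%:R <=
    (q%:R : R) ^ Num.ceil
      (logb (q%:R : R) (2 + 'C(n - 1, d - 1) * (q - 1) ^ (d - 1))%N%:R).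
Proof.
have q1 : (1 < q)%N by rewrite -card_F card_finRing_gt1.
set m := (2 + _)%N; have [|r -> le_mr] := le_exp_ceil_logb R q m q1.
  by rewrite /m.
rewrite -exprnP -natrX ler_nat -card_F; apply: chi_le_expn.
(* With [m = 2 + N], the strict bound [N < q^r] follows from [N + 1 <= m <= q^r]. *)
by rewrite card_F; apply: leq_trans le_mr; rewrite /m add2n ltnS leqnSn.
Qed.
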